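(* Let $\psi: T \to \mathbb{C}$ be a function and $\varphi: T \to T$ a self-map with infinite range (i.e. $\varphi(T)$ is infinite) for which $W_{\psi,\varphi}$ is bounded on $L_\mu^\infty$ (respectively $L_\mu^0$). Then $$\|W_{\psi,\varphi}\|_e = \lim_{N \to \infty}\ \sup_{|\varphi(v)| \ge N} \frac{\mu(v)}{\mu(\varphi(v))}|\psi(v)|$$ as an operator on $L_\mu^\infty$ (respectively $L_\mu^0$), where the supremum is over all $v \in T$ with $|\varphi(v)| \ge N$.
   Context: $(T,\mathrm{d})$ is a metric space with a distinguished point $o$ (the root); the length of $v \in T$ is $|v| = \mathrm{d}(o,v)$. $T$ is assumed locally finite (for every $M>0$ the set $\{v \in T : |v| < M\}$ is finite) and unbounded (for every $M>0$ there is $v \in T$ with $|v| \ge M$). $\mu: T \to (0,\infty)$ is an arbitrary positive function (a weight). $L_\mu^\infty$ is the Banach space of functions $f: T \to \mathbb{C}$ with $\|f\|_\mu = \sup_{v \in T} \mu(v)|f(v)| < \infty$, and $L_\mu^0$ is its closed subspace of those $f$ with $\lim_{|v|\to\infty} \mu(v)|f(v)| = 0$. The weighted composition operator is the linear map $W_{\psi,\varphi} f = \psi\,(f\circ\varphi)$; it is bounded on a space if it is a bounded operator from that space to itself. The essential norm of a bounded operator $A$ on a Banach space $X$ is $\|A\|_e = \inf\{\|A-K\| : K \text{ a compact operator on } X\}$. *)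

(* Defs.v *)
From HB Require Import structures.
From mathcomp Require Import all_boot all_order all_algebra.
From mathcomp Require Import complex.
From mathcomp Require Import all_classical all_reals all_analysis.

Set Implicit Arguments.
Unset Strict Implicit.
Unset Printing Implicit Defensive.

Import Order.TTheory GRing.Theory Num.Theory.
Import numFieldNormedType.Exports.

Local Open Scope classical_set_scope.
Local Open Scope complex_scope.
Local Open Scope ring_scope.

Section rooted_metric_space.
Context (R : realType) (T : metricType R) (o : T).

Definition len (v : T) : R := mdist o v.

Definition locally_finite : Prop :=
  forall M : R, 0 < M -> finite_set [set v | len v < M].

Definition unbounded : Prop :=
  forall M : R, 0 < M -> exists v, M <= len v.

End rooted_metric_space.

Section real_norm.
Context (R : realType) (V : normedModType R[i]).

(* The norm of a normedModType over R[i] takes its nonnegative real values in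
   R[i]; rnorm is the same norm with values in R. For V := R[i]^o it is the
   modulus of a complex number. *)
Definition rnorm (x : V) : R := complex.Re `|x|.

Lemma rnormE (x : V) : (rnorm x)%:C = `|x|.
Proof. by rewrite /rnorm RRe_real// normr_real. Qed.

Lemma rnorm_ge0 (x : V) : 0 <= rnorm x.
Proof. by rewrite -lecR rnormE normr_ge0. Qed.

Lemma rnormD (x y : V) : rnorm (x + y) <= rnorm x + rnorm y.
Proof. by rewrite -lecR rmorphD/= !rnormE ler_normD. Qed.

Lemma rnorm0_eq0 (x : V) : rnorm x = 0 -> x = 0.
Proof. by move=> x0; apply/normr0_eq0; rewrite -rnormE x0. Qed.

Lemma rnorm0 : rnorm 0 = 0.
Proof. by rewrite /rnorm normr0. Qed.

End real_norm.

Lemma rnormZ (R : realType) (V : normedModType R[i]) (a : R[i]) (x : V) :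
  rnorm (a *: x) = rnorm (a : R[i]^o) * rnorm x.
Proof. by apply: complexI; rewrite rmorphM/= !rnormE normrZ. Qed.

Section operators.
Context (R : realType) (V : normedModType R[i]).

Definition bounded_operator (A : {linear V -> V}) : Prop :=
  exists M : R, forall x, rnorm (A x) <= M * rnorm x.

Definition compact_operator (K : {linear V -> V}) : Prop :=
  precompact (K @` [set x | rnorm x <= 1]).

Definition opnorm (A : V -> V) : \bar R :=
  ereal_sup [set (rnorm (A x))%:E | x in [set x | rnorm x <= 1]].

Definition essnorm (A : {linear V -> V}) : \bar R :=
  ereal_inf [set opnorm (A \- K) | K in [set K | compact_operator K]].

End operators.

Section Linf_def.
Context (R : realType) (T : Type) (mu : T -> {posnum R}).

Definition wabs (f : T -> R[i]^o) (v : T) : R := (mu v)%:num * rnorm (f v).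

Definition in_Linf : {pred (T -> R[i]^o)} :=
  fun f => `[< has_ubound (range (wabs f)) >].

Lemma in_LinfP f : reflect (has_ubound (range (wabs f))) (f \in in_Linf).
Proof. exact: asboolP. Qed.

Lemma wabs_ge0 f v : 0 <= wabs f v.
Proof. by rewrite mulr_ge0// rnorm_ge0. Qed.

Lemma wabsD f g v : wabs (f + g) v <= wabs f v + wabs g v.
Proof. by rewrite -mulrDr ler_wpM2l// rnormD. Qed.

Lemma wabsZ a f v : wabs (a *: f) v = rnorm (a : R[i]^o) * wabs f v.
Proof. by rewrite /wabs rnormZ mulrCA. Qed.

Lemma wabs0 v : wabs 0 v = 0.
Proof. by rewrite /wabs rnorm0 mulr0. Qed.

Fact in_Linf_submod_closed : submod_closed in_Linf.
Proof.
split.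
  by apply/in_LinfP; exists 0 => _ [v _ <-]; rewrite wabs0.
move=> a f g /in_LinfP[M Mf] /in_LinfP[N Ng]; apply/in_LinfP.
exists (rnorm (a : R[i]^o) * M + N) => _ [v _ <-].
rewrite (le_trans (wabsD _ _ _))// lerD//; last by apply: Ng; exists v.
by rewrite wabsZ ler_wpM2l ?rnorm_ge0//; apply: Mf; exists v.
Qed.

HB.instance Definition _ :=
  GRing.isSubmodClosed.Build R[i] (T -> R[i]^o) in_Linf in_Linf_submod_closed.

Record Linf := MkLinf {
  Linf_fun :> T -> R[i]^o ;
  Linf_funP : Linf_fun \in in_Linf }.

HB.instance Definition _ := [isSub for Linf_fun].
HB.instance Definition _ := [Choice of Linf by <:].
HB.instance Definition _ := [SubChoice_isSubLmodule of Linf by <:].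

Definition Linf_norm (f : Linf) : R := sup (range (wabs f)).

Lemma wabs_le_Linf_norm (f : Linf) v : wabs f v <= Linf_norm f.
Proof. by apply: ub_le_sup; [exact/in_LinfP/Linf_funP | exists v]. Qed.

Lemma Linf_norm_ge0 (f : Linf) : 0 <= Linf_norm f.
Proof.
have [[v _]|T0] := pselect (exists v : T, True).
  exact: le_trans (wabs_ge0 f v) (wabs_le_Linf_norm f v).
rewrite /Linf_norm (_ : range _ = set0) ?sup0//.
by rewrite -subset0 => y [v _ _]; apply: T0; exists v.
Qed.

Lemma Linf_norm_le (f : Linf) (M : R) :
  0 <= M -> (forall v, wabs f v <= M) -> Linf_norm f <= M.
Proof.
move=> M0 fM; have [[v _]|T0] := pselect (exists v : T, True).
  apply: ge_sup => [|_ [w _ <-]//]; by exists (wabs f v), v.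
rewrite /Linf_norm (_ : range _ = set0) ?sup0//.
by rewrite -subset0 => y [v _ _]; apply: T0; exists v.
Qed.

Fact Linf_normD (f g : Linf) :
  (Linf_norm (f + g))%:C <= (Linf_norm f)%:C + (Linf_norm g)%:C.
Proof.
rewrite -rmorphD/= lecR; apply: Linf_norm_le => [|v].
  by rewrite addr_ge0// Linf_norm_ge0.
by rewrite (le_trans (wabsD _ _ _))// lerD// wabs_le_Linf_norm.
Qed.

Fact Linf_normZ (a : R[i]) (f : Linf) :
  (Linf_norm (a *: f))%:C = `|a| * (Linf_norm f)%:C.
Proof.
rewrite -[`|a|](@rnormE _ R[i]^o) -rmorphM/=; congr (_%:C).
apply/eqP; rewrite eq_le; apply/andP; split.
  apply: Linf_norm_le => [|v].
    by rewrite mulr_ge0 ?rnorm_ge0// Linf_norm_ge0.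
  rewrite wabsZ.
  by rewrite ler_wpM2l ?rnorm_ge0// wabs_le_Linf_norm.
have [->|a0] := eqVneq (rnorm (a : R[i]^o)) 0.
  by rewrite mul0r Linf_norm_ge0.
have {}a0 : 0 < rnorm (a : R[i]^o) by rewrite lt0r a0 rnorm_ge0.
rewrite mulrC -ler_pdivlMr//; apply: Linf_norm_le => [|v].
  by rewrite divr_ge0 ?Linf_norm_ge0 ?ltW.
by rewrite ler_pdivlMr// mulrC -wabsZ (wabs_le_Linf_norm (a *: f)).
Qed.

Fact Linf_norm0_eq0 (f : Linf) : (Linf_norm f)%:C = 0 -> f = 0.
Proof.
move=> /complexI f0; apply/val_inj/funext => v; apply: rnorm0_eq0.
have /eqP : wabs f v = 0.
  by apply/eqP; rewrite eq_le wabs_ge0 -f0 wabs_le_Linf_norm.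
by rewrite mulf_eq0 gt_eqF//= => /eqP.
Qed.

HB.instance Definition _ :=
  Lmodule_isNormed.Build R[i] Linf Linf_normD Linf_normZ Linf_norm0_eq0.

Lemma rnorm_Linf (f : Linf) : rnorm f = sup (range (wabs f)).
Proof. by []. Qed.

End Linf_def.

Section L0_def.
Context (R : realType) (T : metricType R) (o : T) (mu : T -> {posnum R}).

Definition in_L0 : {pred Linf mu} :=
  fun f => `[< forall e : R, 0 < e ->
    exists M : R, forall v, M <= len o v -> wabs mu f v < e >].

Lemma in_L0P (f : Linf mu) :
  reflect (forall e : R, 0 < e ->
             exists M : R, forall v, M <= len o v -> wabs mu f v < e)
          (f \in in_L0).
Proof. exact: asboolP. Qed.

Fact in_L0_submod_closed : submod_closed in_L0.
Proof.
split.
  by apply/in_L0P => e e0; exists 0 => v _; rewrite wabs0.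
move=> a f g /in_L0P f0 /in_L0P g0; apply/in_L0P => e e0.
have a0 : 0 < rnorm (a : R[i]^o) + 1 by rewrite ltr_wpDl ?rnorm_ge0.
have [M Mf] := f0 (e / 2 / (rnorm (a : R[i]^o) + 1)) ltac:(by rewrite !divr_gt0).
have [N Ng] := g0 (e / 2) ltac:(by rewrite divr_gt0).
exists (Num.max M N) => v; rewrite ge_max => /andP[/Mf fv /Ng gv].
apply: (le_lt_trans (wabsD mu (a *: (f : T -> R[i]^o)) g v)).
rewrite [ltRHS]splitr ler_ltD// wabsZ.
move: fv; rewrite ltr_pdivlMr// => /ltW; apply: le_trans.
by rewrite mulrC ler_wpM2l ?wabs_ge0// lerDl.
Qed.

HB.instance Definition _ :=
  GRing.isSubmodClosed.Build R[i] (Linf mu) in_L0 in_L0_submod_closed.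

Record L0 := MkL0 {
  L0_Linf :> Linf mu ;
  L0_LinfP : L0_Linf \in in_L0 }.

HB.instance Definition _ := [isSub for L0_Linf].
HB.instance Definition _ := [Choice of L0 by <:].
HB.instance Definition _ := [SubChoice_isSubLmodule of L0 by <:].

Definition L0_norm (f : L0) : R[i] := `|L0_Linf f|.

Fact L0_normD (f g : L0) : L0_norm (f + g) <= L0_norm f + L0_norm g.
Proof. exact: ler_normD. Qed.

Fact L0_normZ (a : R[i]) (f : L0) : L0_norm (a *: f) = `|a| * L0_norm f.
Proof. exact: normrZ. Qed.

Fact L0_norm0_eq0 (f : L0) : L0_norm f = 0 -> f = 0.
Proof. by move=> /normr0_eq0 f0; exact/val_inj. Qed.

HB.instance Definition _ :=
  Lmodule_isNormed.Build R[i] L0 L0_normD L0_normZ L0_norm0_eq0.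

Lemma rnorm_L0 (f : L0) : rnorm f = sup (range (wabs mu f)).
Proof. by []. Qed.

End L0_def.

Definition wcomp (R : realType) (T : Type) (psi : T -> R[i]) (phi : T -> T)
  (f : T -> R[i]^o) : T -> R[i]^o := fun v => psi v * f (phi v).

(* The supremum is taken in \bar R so that it needs no boundedness side
   condition. *)
Definition tail_sup (R : realType) (T : metricType R) (o : T)
    (mu : T -> {posnum R}) (psi : T -> R[i]) (phi : T -> T) (N : nat) : \bar R :=
  ereal_sup [set ((mu v)%:num / (mu (phi v))%:num * rnorm (psi v : R[i]^o))%:E
            | v in [set v | N%:R <= len o (phi v)]].

(* Main.v *)
(** Upper bound: composing [W] with the restriction of functions to the finite
    set [{w | len w < N}] gives a finite-rank operator [K], and [W - K] only
    sees the values at the [v] with [len (phi v) >= N].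

    Lower bound: let [e_w] be the point mass at [w], normalized. A sum of
    distinct [e_w] has norm at most 1, which forces [0] to be the only cluster
    point of [K e_{w_n}] when [K] is compact and [len w_n] tends to infinity,
    so [K e_{w_n}] is small for some [n]; no weak convergence is needed. At the
    same time [W e_{phi v}] takes at [v] the weighted value
    [mu v / mu (phi v) * |psi v|]. *)
Require Import Defs.
From HB Require Import structures.
From mathcomp Require Import all_boot all_order all_algebra.
From mathcomp Require Import complex.
From mathcomp Require Import all_classical all_reals all_analysis.

Set Implicit Arguments.
Unset Strict Implicit.
Unset Printing Implicit Defensive.

Import Order.TTheory GRing.Theory Num.Theory.
Import numFieldNormedType.Exports.

Local Open Scope classical_set_scope.
Local Open Scope complex_scope.
Local Open Scope ring_scope.

(** * The real-valued norm and compact sets of linear combinations *)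

Section real_norm_theory.
Context (R : realType) (V : normedModType R[i]).
Implicit Types (x y : V) (A B : set V).

Lemma rnorm_le_add_dist x y : rnorm x <= rnorm y + rnorm (x - y).
Proof. by rewrite -{1}(subrKC y x) rnormD. Qed.

Lemma rnormN x : rnorm (- x) = rnorm x.
Proof. by rewrite /rnorm normrN. Qed.

Lemma rnorm_ltC x (e : R) : `|x| < e%:C -> rnorm x < e.
Proof. by rewrite -rnormE ltcR. Qed.

Lemma dist_rnorm_le x y : `|rnorm x - rnorm y| <= rnorm (x - y).
Proof.
rewrite ler_norml lerNl opprB !lerBlDl rnorm_le_add_dist andbT.
by rewrite -[rnorm (x - y)]rnormN opprB rnorm_le_add_dist.
Qed.

Lemma nbhs_rnorm_lt x (e : R) : 0 < e -> \forall y \near x, rnorm (x - y) < e.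
Proof.
move=> e0; have /cvgrPdist_lt/(_ e%:C) : y @[y --> x] --> x by exact: cvg_id.
rewrite ltcR => /(_ e0); apply: filterS => y; exact: rnorm_ltC.
Qed.

Lemma rnorm_continuous : continuous (@rnorm R V).
Proof.
move=> x; apply/cvgrPdist_lt => e e0.
have := nbhs_rnorm_lt x e0.
by apply: filterS => y; exact/le_lt_trans/dist_rnorm_le.
Qed.

Lemma rnorm_sum (I : Type) (s : seq I) (F : I -> V) :
  rnorm (\sum_(i <- s) F i) <= \sum_(i <- s) rnorm (F i).
Proof.
elim/big_ind2 : _ => [|x a y b xa yb|//]; first by rewrite rnorm0.
by rewrite (le_trans (rnormD _ _))// lerD.
Qed.

Lemma precompact_rnorm_bounded A : precompact A ->
  exists M : R, forall x, A x -> rnorm x <= M.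
Proof.
rewrite precompactE => cA.
have /compact_bounded[M [_ AM]] : compact (@rnorm R V @` closure A).
  by apply: continuous_compact cA; exact/continuous_subspaceT/rnorm_continuous.
exists (M + 1) => x Ax; rewrite -[leLHS]ger0_norm ?rnorm_ge0//.
by apply: AM; [rewrite ltrDl | exists x => //; exact: subset_closure].
Qed.

Lemma compactD A B : compact A -> compact B ->
  compact [set p.1 + p.2 | p in A `*` B].
Proof.
move=> cA cB; apply: continuous_compact (compact_setX cA cB).
by apply: continuous_subspaceT => p; exact: add_continuous.
Qed.

Lemma realC_scale_continuous x : continuous (fun t : R => t%:C *: x : V).
Proof.
move=> t; apply/cvgrPdist_lt => e e0.
have [x0|x0] := eqVneq (rnorm x) 0.
  by near=> s; rewrite (rnorm0_eq0 x0) !scaler0 subrr normr0.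
have {}x0 : 0 < rnorm x by rewrite lt0r x0 rnorm_ge0.
(* A positive element of [R[i]] is real, so the estimate can be made in [R]. *)
have eRe : e = (complex.Re e)%:C by rewrite RRe_real// gtr0_real.
rewrite eRe ltcR in e0.
have /cvgrPdist_lt/(_ _ (divr_gt0 e0 x0)) : s @[s --> t] --> t by exact: cvg_id.
apply: filterS => s.
rewrite ltr_pdivlMr// -scalerBl normrZ -rnormE -rmorphB/= normc_def/=.
by rewrite expr0n addr0 sqrtr_sqr -rmorphM/= eRe ltcR.
Unshelve. all: by end_near. Qed.

(** The disc of radius [r] lies in the square of side [2 * r], and the multiples of [x] by that
    square form the sum of two segments, one along [x] and one along ['i *: x], each compact as a
    continuous image of a real interval. *)
Lemma compact_scale_ball x (r : R) : exists2 C : set V, compact C &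
  forall c : R[i]^o, rnorm c <= r -> C (c *: x).
Proof.
exists [set p.1 + p.2 | p in ((fun t : R => t%:C *: x) @` `[- r, r]) `*`
                             ((fun t : R => t%:C *: ('i *: x)) @` `[- r, r])].
  by apply: compactD; apply: continuous_compact (@segment_compact R _ _);
    exact/continuous_subspaceT/realC_scale_continuous.
move=> c cr; have Rec : `|complex.Re c| <= r /\ `|complex.Im c| <= r.
  suff : `|complex.Re c| <= rnorm c /\ `|complex.Im c| <= rnorm c.
    by move=> [? ?]; split; exact: le_trans cr.
  rewrite /rnorm normc_def/= -[`|complex.Re c|]sqrtr_sqr.
  rewrite -[`|complex.Im c|]sqrtr_sqr.
  by rewrite !ler_wsqrtr ?lerDl ?lerDr ?sqr_ge0.
exists ((complex.Re c)%:C *: x, (complex.Im c)%:C *: ('i *: x)) => /=.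
  by split; [exists (complex.Re c) | exists (complex.Im c)] => //=;
    rewrite in_itv/= -ler_norml; case: Rec.
by rewrite scalerA -scalerDl {3}[c]complexE mulrC.
Qed.

(** This is the source of compactness for finite-rank operators: one compact set serves all
    coefficient families bounded by [r]. *)
Lemma compact_bounded_combinations (I : Type) (s : seq I) (e : I -> V)
    (r : I -> R) : exists2 C : set V, compact C &
  forall c : I -> R[i]^o, (forall i, rnorm (c i) <= r i) ->
    C (\sum_(i <- s) c i *: e i).
Proof.
elim: s => [|i s [C cC sC]].
  by exists [set 0]; [exact: compact_set1 | move=> c _; rewrite big_nil].
have [D cD rD] := compact_scale_ball (e i) (r i).
exists [set p.1 + p.2 | p in D `*` C]; first exact: compactD.
move=> c cr; exists (c i *: e i, \sum_(j <- s) c j *: e j).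
  by split; [exact: rD | exact: sC].
by rewrite big_cons.
Qed.

End real_norm_theory.

Lemma rnormM (R : realType) (a b : R[i]) :
  rnorm (a * b : R[i]^o) = rnorm (a : R[i]^o) * rnorm (b : R[i]^o).
Proof. exact: (@rnormZ R R[i]^o). Qed.

Lemma rnorm_realC (R : realType) (r : R) : rnorm (r%:C : R[i]^o) = `|r|.
Proof. by rewrite /rnorm normc_def/= expr0n addr0 sqrtr_sqr. Qed.

(** * Point masses in an abstract weighted sup space *)

Definition delta (R : realType) (T : metricType R) (w : T) : T -> R[i]^o :=
  fun v => (v == w)%:R.

Lemma scale_deltaE (R : realType) (T : metricType R) (a : R[i]) (w v : T) :
  (a *: delta w) v = a * (v == w)%:R.
Proof. by []. Qed.

(* Both [Linf mu] and [L0 o mu] are instances; [ev] forgets the bounds on the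
   function. *)
Record weighted_sup_space (R : realType) (T : metricType R)
    (mu : T -> {posnum R}) (V : normedModType R[i])
    (ev : {linear V -> (T -> R[i]^o)}) : Prop := WeightedSupSpace {
  wabs_le_rnorm : forall x v, wabs mu (ev x) v <= rnorm x ;
  rnorm_le : forall x (M : R), 0 <= M ->
    (forall v, wabs mu (ev x) v <= M) -> rnorm x <= M ;
  ev_delta : forall w, exists x, ev x = delta w }.

Section weighted_sup_space_theory.
Context (R : realType) (T : metricType R) (o : T) (mu : T -> {posnum R}).
Context (V : normedModType R[i]) (ev : {linear V -> (T -> R[i]^o)}).
Context (evP : weighted_sup_space mu ev).

Lemma ev_inj : injective ev.
Proof.
move=> x y xy; apply/eqP; rewrite -subr_eq0; apply/eqP/rnorm0_eq0.
apply/eqP; rewrite eq_le rnorm_ge0 andbT; apply: (rnorm_le evP) => // v.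
by rewrite linearB/= xy subrr wabs0.
Qed.

Lemma ev_normalized_delta (w : T) :
  exists x, ev x = (mu w)%:num^-1%:C *: delta w.
Proof.
have [x xw] := ev_delta evP w.
by exists ((mu w)%:num^-1%:C *: x); rewrite linearZ/= xw.
Qed.

(** The supports are disjoint because [s] has no repetition, so at each point at most one term is
    nonzero, and its weighted value there is 1. *)
Lemma rnorm_sum_normalized_delta (e : T -> V) (s : seq T) :
  (forall w, ev (e w) = (mu w)%:num^-1%:C *: delta w) -> uniq s ->
  rnorm (\sum_(w <- s) e w) <= 1.
Proof.
move=> eE us; apply: (rnorm_le evP) => // v.
rewrite linear_sum/= /wabs fct_sumE.
under eq_bigr do rewrite eE scale_deltaE.
have [vs|vs] := boolP (v \in s); last first.
  rewrite big1_seq ?rnorm0 ?mulr0// => w /= ws.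
  by rewrite eq_sym (negbTE (memPn vs w ws)) mulr0.
rewrite (bigD1_seq v)//= big1 ?addr0 => [|w wv]; last first.
  by rewrite eq_sym (negbTE wv) mulr0.
rewrite eqxx mulr1 rnorm_realC.
by rewrite gtr0_norm ?invr_gt0// mulfV// gt_eqF.
Qed.

(* If [g] is a cluster point of [K (e (w n))], then [K] maps the sum of [m]
   suitable [e (w n)], a vector of norm at most 1, close to [m * g]; as [K] is
   bounded, [g = 0]. *)
Lemma compact_operator_small (K : {linear V -> V}) (e : T -> V) (w : nat -> T) :
  compact_operator K ->
  (forall w, ev (e w) = (mu w)%:num^-1%:C *: delta w) ->
  (forall n, n%:R <= len o (w n)) ->
  forall eps : R, 0 < eps -> exists n, rnorm (K (e (w n))) < eps.
Proof.
move=> cK eE wn.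
have Ke v : (K @` [set x | rnorm x <= 1]) (K (e v)).
  exists (e v) => //=; have := @rnorm_sum_normalized_delta e [:: v] eE erefl.
  by rewrite big_seq1.
have [M KM] := precompact_rnorm_bounded cK.
have [g [_ gP]] : (closure (K @` [set x | rnorm x <= 1]) `&`
    cluster (K (e (w n)) @[n --> \oo])) !=set0.
  have cKc : compact (closure (K @` [set x | rnorm x <= 1])).
    by rewrite -precompactE.
  by apply: cKc; exists 0%N => // n _; exact: subset_closure.
have near_g (eps : R) (N : nat) : 0 < eps ->
    exists2 n, (N <= n)%N & rnorm (g - K (e (w n))) < eps.
  move=> eps0.
  have [_ [[n Nn <-] gn]] := gP [set K (e (w n)) | n in [set n | (N <= n)%N]]
    _ (ltac:(by exists N => // n Nn; exists n)) (nbhs_rnorm_lt g eps0).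
  by exists n.
suff g0 : g = 0.
  move=> eps eps0; have [n _] := near_g _ 0%N eps0.
  by rewrite g0 sub0r rnormN; exists n.
apply: contrapT => /eqP gn0.
have g0 : 0 < rnorm g / 2.
  rewrite divr_gt0// lt0r rnorm_ge0 andbT.
  by apply: contra_neq gn0; exact: rnorm0_eq0.
have near_gs m : exists s : seq T, [/\ uniq s, size s = m &
    {in s, forall v, rnorm (g - K (e v)) <= rnorm g / 2}].
  elim: m => [|m [s [us sm sg]]]; first by exists [::].
  (* An index [n >= N] exceeds the length of every point already in [s], while [len o (w n) >= n];
     hence [w n] is a new point. *)
  pose N := (\max_(v <- s) (Num.truncn (len o v)).+1)%N.
  have [n Nn gn] := near_g _ N g0.
  exists (w n :: s); split=> /=; last 2 first.
  - by rewrite sm.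
  - by move=> v; rewrite inE => /predU1P[->|/sg//]; exact: ltW.
  rewrite us andbT; apply/negP => wns.
  have : ((Num.truncn (len o (w n))).+1 <= n)%N.
    by apply: leq_trans Nn; rewrite /N (big_rem _ wns)/= leq_maxl.
  rewrite -(ler_nat R) => /(lt_le_trans (truncnS_gt _)).
  by rewrite ltNge wn.
(* The number [m] of points is chosen with [m * (rnorm g / 2) > M], against the bound
   [m * rnorm g <= m * (rnorm g / 2) + M] derived below. *)
have [s [us sm sg]] := near_gs (Num.truncn (M / (rnorm g / 2))).+1.
set m := size s in sm.
have KsM : rnorm (\sum_(v <- s) K (e v)) <= M.
  rewrite -linear_sum; apply: KM; exists (\sum_(v <- s) e v) => //=.
  exact: rnorm_sum_normalized_delta.
have : rnorm (g *+ m) <= (rnorm g / 2) *+ m + M.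
  rewrite (_ : g *+ m = \sum_(v <- s) (g - K (e v)) + \sum_(v <- s) K (e v)).
    rewrite (le_trans (rnormD _ _))// lerD// (le_trans (rnorm_sum _ _))//.
    rewrite [leLHS]big_seq (le_trans (ler_sum _ sg))//.
    by rewrite -big_seq big_const_seq count_predT iter_addr_0.
  by rewrite sumrB subrK big_const_seq count_predT iter_addr_0.
have -> : rnorm (g *+ m) = rnorm g *+ m.
  by apply: complexI; rewrite rmorphMn/= !rnormE normrMn.
rewrite {1}(splitr (rnorm g)) mulrnDl lerD2l leNgt => /negP; apply.
by rewrite -[_ *+ m]mulr_natl -ltr_pdivrMr// sm truncnS_gt.
Qed.

(** * Lower and upper bounds for a weighted composition operator *)

Context (psi : T -> R[i]) (phi : T -> T) (W : {linear V -> V}).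
Context (WE : forall x, ev (W x) = wcomp psi phi (ev x)).

Lemma tail_sup_nonincreasing :
  {homo tail_sup o mu psi phi : m n / (m <= n)%N >-> (n <= m)%E}.
Proof.
move=> m n mn; apply: ereal_sup_le => _ [v nv <-]; exists v => //=.
by apply: le_trans nv; rewrite ler_nat.
Qed.

(** Otherwise every tail contains a point [v n] whose ratio exceeds [opnorm (W \- K) + eps]. The
    normalized point mass at [phi (v n)] is sent by [W] to a vector of norm at least that ratio, and
    for some [n] its image under [K] has norm below [eps], a contradiction. *)
Lemma tail_sup_le_opnorm (K : {linear V -> V}) : compact_operator K ->
  (ereal_inf (range (tail_sup o mu psi phi)) <= opnorm (W \- K)%R)%E.
Proof.
move=> cK; apply/lee_addgt0Pr => eps eps0; rewrite leNgt; apply/negP => lt_inf.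
have opnorm_ub x : rnorm x <= 1 ->
    ((rnorm (W x - K x)%R)%:E <= opnorm (W \- K)%R)%E.
  by move=> x1; apply: ereal_sup_ubound; exists x.
(* The zero vector excludes [-oo], and [+oo] would contradict [lt_inf]; the rest of the argument is
   in [R]. *)
have opnorm_fin : opnorm (W \- K) \is a fin_num.
  rewrite fin_numE; apply/andP; split; apply/negP => /eqP opE.
    by have := opnorm_ub 0; rewrite opE rnorm0 ler01 leNgt ltNyr => /(_ erefl).
  by move: lt_inf; rewrite opE addye// ltNge leey.
rewrite -(fineK opnorm_fin) -EFinD in lt_inf.
have /choice[v vP] : forall n : nat, exists v, n%:R <= len o (phi v) /\
    fine (opnorm (W \- K)) + eps <
    (mu v)%:num / (mu (phi v))%:num * rnorm (psi v : R[i]^o).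
  move=> n; have /ereal_sup_gt[_ [v nv <-]] := lt_le_trans lt_inf
    (ereal_inf_lbound (ex_intro2 _ _ n I erefl)).
  by rewrite lte_fin => lt_v; exists v.
have /choice[e eE] := ev_normalized_delta.
have [n Kn] := compact_operator_small cK eE (fun n => (vP n).1) eps0.
have e1 : rnorm (e (phi (v n))) <= 1.
  have := @rnorm_sum_normalized_delta e [:: phi (v n)] eE erefl.
  by rewrite big_seq1.
have := opnorm_ub _ e1; rewrite -(fineK opnorm_fin) lee_fin leNgt => /negP; apply.
rewrite -(ltrD2r eps) (lt_le_trans (vP n).2)//.
apply: (@le_trans _ _ (rnorm (W (e (phi (v n)))))).
  apply: le_trans (wabs_le_rnorm evP _ (v n)).
  rewrite WE /wabs /wcomp eE scale_deltaE eqxx mulr1 rnormM rnorm_realC.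
  by rewrite gtr0_norm ?invr_gt0// mulrAC mulrA.
rewrite (le_trans (rnorm_le_add_dist _ (K (e (phi (v n))))))//.
by rewrite addrC lerD2l ltW.
Qed.

(** When [d w] represents the point mass at [w], this is [W] applied to the restriction of [x] to
    [s]. The map [d] is a parameter because [ev_delta] only asserts that such vectors exist. *)
Definition wcomp_trunc (s : seq T) (d : T -> V) (x : V) : V :=
  \sum_(w <- s) ev x w *: W (d w).

Fact wcomp_trunc_linear s d : linear (wcomp_trunc s d).
Proof.
move=> a x y; rewrite /wcomp_trunc scaler_sumr -big_split/=.
by apply: eq_bigr => w _; rewrite linearP/= scalerDl scalerA.
Qed.

HB.instance Definition _ s d :=
  GRing.isLinear.Build R[i] V V _ (wcomp_trunc s d) (wcomp_trunc_linear s d).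

(** On the unit ball the coefficient [ev x w] has modulus at most the inverse of [mu w], so all
    images lie in one compact set of bounded combinations. *)
Lemma wcomp_trunc_compact s d : compact_operator (wcomp_trunc s d).
Proof.
have [C cC sC] := compact_bounded_combinations s (W \o d)
  (fun w => (mu w)%:num^-1).
apply: precompact_subset (compact_precompact (@norm_hausdorff _ _) cC).
move=> _ [x /= x1 <-]; apply: sC => w.
rewrite -[leRHS]mul1r ler_pdivlMr// mulrC.
exact: le_trans (wabs_le_rnorm evP x w) x1.
Qed.

Lemma ev_subr_wcomp_trunc s d x v : (forall w, ev (d w) = delta w) -> uniq s ->
  ev (W x - wcomp_trunc s d x) v =
  if phi v \in s then 0 else psi v * ev x (phi v).
Proof.
move=> dE us.
have termE w : ev (ev x w *: W (d w)) v = ev x w * (psi v * (phi v == w)%:R).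
  by rewrite linearZ/= WE dE.
rewrite linearB linear_sum/= !fctE WE fct_sumE; under eq_bigr do rewrite termE.
case: ifPn => vs.
  rewrite (bigD1_seq (phi v))//= big1 => [|w wv]; last first.
    by rewrite eq_sym (negbTE wv) !mulr0.
  by rewrite eqxx mulr1 addr0 mulrC subrr.
rewrite big1_seq ?subr0// => w /= ws.
by rewrite eq_sym (negbTE (memPn vs w ws)) !mulr0.
Qed.

Context (T_lf : locally_finite o) (phi_infinite : infinite_set (range phi)).

(** An infinite range cannot lie in a ball, which is finite. Hence each [tail_sup] is over a
    nonempty set and is not [-oo]. *)
Lemma phi_unbounded (N : nat) : exists v, N%:R <= len o (phi v).
Proof.
apply: contrapT => /forallNP phiN; apply: phi_infinite.
have /T_lf : 0 < N.+1%:R :> R by [].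
apply: sub_finite_set => _ [v _ <-] /=.
have /negP := phiN v; rewrite -ltNge => /lt_le_trans; apply.
by rewrite ler_nat.
Qed.

Lemma essnorm_le_tail_sup (N : nat) :
  (essnorm W <= tail_sup o mu psi phi N)%E.
Proof.
(* The radius is [N.+1] because [locally_finite] asks for a positive one and [N] may be 0; points
   outside the larger ball still have length at least [N]. *)
have /T_lf/finite_seqP[s0 s0E] : 0 < N.+1%:R :> R by [].
pose s := undup s0.
have sE v : v \notin s -> N%:R <= len o v.
  rewrite mem_undup; apply: contraNT; rewrite -ltNge => vN.
  have : [set v | len o v < N.+1%:R] v by rewrite /= (lt_trans vN)// ltr_nat.
  by rewrite s0E.
have /choice[d dE] := ev_delta evP.
apply: (@le_trans _ _ (opnorm (W \- wcomp_trunc s d))).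
  by apply: ereal_inf_lbound; exists (wcomp_trunc s d) => //;
    exact: wcomp_trunc_compact.
apply: ge_ereal_sup => _ [x /= x1 <-].
have ratio_le v : phi v \notin s ->
    (((mu v)%:num / (mu (phi v))%:num * rnorm (psi v : R[i]^o))%:E <=
     tail_sup o mu psi phi N)%E.
  by move=> vs; apply: ereal_sup_ubound; exists v => //=; exact: sE.
have tail_ge0 : (0 <= tail_sup o mu psi phi N)%E.
  have [v Nv] := phi_unbounded N.
  apply: (@le_trans _ _ ((mu v)%:num / (mu (phi v))%:num
                         * rnorm (psi v : R[i]^o))%:E).
    by rewrite lee_fin mulr_ge0 ?rnorm_ge0.
  by apply: ereal_sup_ubound; exists v.
case tE : (tail_sup o mu psi phi N) => [t| |]; last first.
- by move: tail_ge0; rewrite tE.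
- by rewrite leey.
rewrite lee_fin; rewrite tE lee_fin in tail_ge0.
apply: (rnorm_le evP) => // v; rewrite /wabs ev_subr_wcomp_trunc ?undup_uniq//.
case: ifPn => [_|vs]; first by rewrite rnorm0 mulr0.
have := ratio_le _ vs; rewrite tE lee_fin => vt.
(* The weighted value at [v] factors as the ratio at [v], at most [t], times the weighted value of
   [x] at [phi v], at most 1. *)
rewrite rnormM (_ : _ * _ = (mu v)%:num / (mu (phi v))%:num * rnorm (psi v : R[i]^o)
                     * wabs mu (ev x) (phi v)); last first.
  by rewrite /wabs [RHS]mulrACA divfK ?gt_eqF.
rewrite -[leRHS]mulr1 ler_pM ?wabs_ge0 ?mulr_ge0 ?rnorm_ge0//.
exact: le_trans (wabs_le_rnorm evP _ _) x1.
Qed.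

Lemma essnorm_wcomp : tail_sup o mu psi phi N @[N --> \oo] --> essnorm W.
Proof.
(* The tails shrink with [N], so their suprema converge to their infimum, which the two bounds
   identify with [essnorm W]. *)
suff -> : essnorm W = ereal_inf (range (tail_sup o mu psi phi)).
  exact/ereal_nonincreasing_cvgn/tail_sup_nonincreasing.
apply/eqP; rewrite eq_le; apply/andP; split.
  by apply: le_ereal_inf_tmp => _ [N _ <-]; exact: essnorm_le_tail_sup.
by apply: le_ereal_inf_tmp => _ [K cK <-]; exact: tail_sup_le_opnorm.
Qed.

End weighted_sup_space_theory.

(** * The two function spaces as weighted sup spaces *)

Section function_spaces.
Context (R : realType) (T : metricType R) (o : T) (mu : T -> {posnum R}).

Lemma wabs_delta_eq0 (w v : T) : v != w -> wabs mu (delta w) v = 0.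
Proof. by move=> vw; rewrite /wabs /delta (negbTE vw) rnorm0 mulr0. Qed.

Lemma in_Linf_delta (w : T) : delta w \in in_Linf mu.
Proof.
apply/in_LinfP; exists (wabs mu (delta w) w) => _ [v _ <-].
by have [->//|vw] := eqVneq v w; rewrite wabs_delta_eq0// wabs_ge0.
Qed.

Lemma Linf_weighted_sup_space :
  weighted_sup_space mu (\val : {linear Linf mu -> (T -> R[i]^o)}).
Proof.
split => [f v|f M M0 fM|w].
- exact: wabs_le_Linf_norm.
- exact: Linf_norm_le.
- by exists (MkLinf (in_Linf_delta w)).
Qed.

Definition L0_ev : {linear L0 o mu -> (T -> R[i]^o)} :=
  (\val : {linear Linf mu -> (T -> R[i]^o)})
    \o (\val : {linear L0 o mu -> Linf mu}).

Lemma in_L0_delta (w : T) : MkLinf (in_Linf_delta w) \in @in_L0 R T o mu.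
Proof.
(* The threshold [len o w + 1] excludes [w], the only point where the point mass is nonzero. *)
apply/in_L0P => e e0; exists (len o w + 1) => v wv.
rewrite wabs_delta_eq0//; apply: contraTneq wv => ->.
by rewrite -ltNge ltrDl.
Qed.

Lemma L0_weighted_sup_space : weighted_sup_space mu L0_ev.
Proof.
split => [f v|f M M0 fM|w].
- exact: wabs_le_Linf_norm.
- exact: Linf_norm_le.
- by exists (MkL0 (in_L0_delta w)).
Qed.

End function_spaces.

Theorem theorem4p4 (R : realType) (T : metricType R) (o : T)
    (mu : T -> {posnum R}) (psi : T -> R[i]) (phi : T -> T)
    (T_lf : locally_finite o) (T_unbounded : unbounded o)
    (phi_infinite : infinite_set (range phi)) :
  (forall W : {linear Linf mu -> Linf mu},
     (forall f, W f = wcomp psi phi f :> (T -> R[i]^o)) ->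
     bounded_operator W ->
     tail_sup o mu psi phi N @[N --> \oo] --> essnorm W)
  /\
  (forall W : {linear L0 o mu -> L0 o mu},
     (forall f, W f = wcomp psi phi f :> (T -> R[i]^o)) ->
     bounded_operator W ->
     tail_sup o mu psi phi N @[N --> \oo] --> essnorm W).
Proof.
split=> W WE _.
- exact: (essnorm_wcomp (Linf_weighted_sup_space mu)).
- exact: (essnorm_wcomp (L0_weighted_sup_space o mu)).
Qed.
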